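(* For every integer $d\ge 1$, $$p_{shield}(d)\le 1-\lambda(d)^{-\frac{1}{2d-1}}.$$
   Context: Let $\mathcal{E}^d$ be the set of nearest-neighbor edges of $\mathbb{Z}^d$. For $p\in[0,1]$, $\mathbb{P}_p$ is the product measure on $\{0,1\}^{\mathcal{E}^d}$ under which each edge $e$ is independently open ($\omega(e)=1$) with probability $p$ and closed ($\omega(e)=0$) with probability $1-p$. A path is an alternating sequence of vertices and edges $v_0,e_0,v_1,e_1,\dots$ in which $e_i\in\mathcal{E}^d$ has endpoints $v_i$ and $v_{i+1}$. A vertex $x\in\mathbb{Z}^d$ is shielded if all $2d$ edges incident to $x$ are closed. A shielded path is a path all of whose vertices are shielded; an infinite shielded path is understood to be an infinite vertex self-avoiding one (vertices $v_0,v_1,v_2,\dots$ all distinct). Define $$p_{shield}(d)=\sup\{p\in[0,1]:\mathbb{P}_p(\text{there exists an infinite shielded path})>0\}.$$ $\lambda(d)$ is the connective constant of vertex self-avoiding walks on $\mathbb{Z}^d$: $$\lambda(d)=\lim_{n\to\infty}\left(\#\{\text{vertex self-avoiding nearest-neighbor paths in }\mathbb{Z}^d\text{ with } n \text{ vertices, started at }0\}\right)^{1/n},$$ where the limit exists by sub-multiplicativity. *)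

(* Defs.v *)
From HB Require Import structures.
From mathcomp Require Import all_boot all_order all_algebra finmap.
From mathcomp Require Import all_classical all_reals all_analysis.
From mathcomp Require Import zify.
Set Implicit Arguments.
Unset Strict Implicit.
Unset Printing Implicit Defensive.
Import Order.TTheory GRing.Theory Num.Theory.
Import numFieldNormedType.Exports.
Local Open Scope classical_set_scope.
Local Open Scope ring_scope.

Definition coordinate_sets (E : Type) : set (set (E -> bool)) :=
  [set [set w : E -> bool | w e] | e in [set: E]].

(* {0,1}^E with the product sigma-algebra; [w e] means that e is open. *)
Definition config (E : Type) := g_sigma_algebraType (@coordinate_sets E).
HB.instance Definition _ (E : Type) := Measurable.on (config E).

Definition is_product_measure (R : realType) (E : choiceType)
    (Q : probability bool R) (P : probability (config E) R) : Prop :=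
  forall (F : {fset E}) (A : E -> set bool),
    P [set w | forall e, e \in F -> A e (w e)]
    = (\prod_(e <- enum_fset F) Q (A e))%E.

(* P_p; well defined for countable E by [bernoulli_productP] and
   [product_measure_unique]. *)
Definition bernoulli_product (R : realType) (E : choiceType) (p : R) :
    probability (config E) R :=
  xget (\d_(point : config E) : probability (config E) R)
       [set P | is_product_measure (bernoulli_prob p) P].

Section Existence.
Context (R : realType) (E : countType) (Q : probability bool R).
Implicit Types (w : E -> bool) (A B : set (E -> bool)) (f g : (E -> bool) -> R).

Let q (b : bool) : R := fine (Q [set b]).

Let QE b : Q [set b] = (q b)%:E.
Proof. by rewrite fineK// fin_num_measure. Qed.

Let q_ge0 b : 0 <= q b.
Proof. by rewrite -lee_fin -QE. Qed.

Let q_sum : q true + q false = 1.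
Proof.
apply: EFin_inj; rewrite EFinD -!QE -(probability_setT Q) setT_bool measureU//.
by rewrite -subset0 => b [/= ->].
Qed.

Definition update (n : nat) (b : bool) w : E -> bool :=
  fun e => if choice.pickle e == n then b else w e.

(* Integration of the coordinate of pickle n, then of the first n ones. *)
Definition average n f w : R :=
  q true * f (update n true w) + q false * f (update n false w).

Fixpoint expect n f : R :=
  if n is m.+1 then expect m (average m f) else f (fun=> false).

Definition depends_below T n (f : (E -> bool) -> T) :=
  forall w w', (forall e, (choice.pickle e < n)%N -> w e = w' e) -> f w = f w'.

Lemma depends_below_le T m n (f : (E -> bool) -> T) :
  (m <= n)%N -> depends_below m f -> depends_below n f.
Proof. by move=> mn fm w w' ww'; apply: fm => e /leq_trans/(_ mn)/ww'. Qed.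

Lemma expect_stable m n f : (m <= n)%N -> depends_below m f ->
  expect n f = expect m f.
Proof.
move=> + fm; elim: n => [|n IH]; first by rewrite leqn0 => /eqP ->.
rewrite leq_eqVlt => /orP[/eqP -> //|]; rewrite ltnS => mn.
rewrite -IH//=; congr expect; apply/funext => w.
have fu b : f (update n b w) = f w.
  apply: fm => e em; rewrite /update; case: eqP => // en.
  by move: em; rewrite en ltnNge mn.
by rewrite /average !fu -mulrDl q_sum mul1r.
Qed.

Lemma expectD n f g : expect n (f \+ g) = expect n f + expect n g.
Proof.
elim: n f g => [//|n IH] f g /=; rewrite -IH; congr expect; apply/funext => w.
by rewrite /average /= !mulrDr addrACA.
Qed.

Lemma expectZ n (c : R) f : expect n (fun w => f w * c) = expect n f * c.
Proof.
elim: n f => [//|n IH] f /=; rewrite -IH; congr expect; apply/funext => w.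
by rewrite /average /= !mulrA -mulrDl.
Qed.

Lemma expect_le n f g : (forall w, f w <= g w) -> expect n f <= expect n g.
Proof.
elim: n f g => [//|n IH] f g fg /=; first exact: fg.
by apply: IH => w; rewrite /average lerD// ler_wpM2l.
Qed.

Lemma expect_cst n (c : R) : expect n (fun=> c) = c.
Proof. by rewrite (@expect_stable 0%N). Qed.

Lemma expect_prod n (s : seq E) (h : E -> bool -> R) : uniq s ->
  expect n (fun w => \prod_(e <- s | (choice.pickle e < n)%N) h e (w e))
  = \prod_(e <- s | (choice.pickle e < n)%N) (q true * h e true + q false * h e false).
Proof.
move=> us; elim: n => [|n IH] /=; first by rewrite !big_pred0_eq.
have split (F : E -> R) : \prod_(e <- s | (choice.pickle e < n.+1)%N) F e =
    (\prod_(e <- s | (choice.pickle e < n)%N) F e) *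
    \prod_(e <- s | choice.pickle e == n) F e.
  rewrite (bigID (fun e => choice.pickle e < n)%N)/=; congr (_ * _); apply: eq_bigl => e;
  by rewrite ltnS; case: ltngtP.
rewrite split -IH -expectZ; congr expect; apply/funext => w.
rewrite /average !split.
have below b : \prod_(e <- s | (choice.pickle e < n)%N) h e (update n b w e) =
               \prod_(e <- s | (choice.pickle e < n)%N) h e (w e).
  by apply: eq_bigr => e en; rewrite /update (ltn_eqF en).
have at_n b : \prod_(e <- s | choice.pickle e == n) h e (update n b w e) =
              \prod_(e <- s | choice.pickle e == n) h e b.
  by apply: eq_bigr => e en; rewrite /update en.
rewrite !below !at_n !(mulrCA (q _)) -mulrDr; congr (_ * _).
have [/hasP[e es /eqP en]|/hasPn s_n] := boolP (has (fun e => choice.pickle e == n) s).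
  have pE e' : (choice.pickle e' == n) = (e' == e).
    by rewrite -en (inj_eq (pcan_inj choice.pickleK)).
  have one (F : E -> R) : \prod_(e <- s | choice.pickle e == n) F e = F e.
    by rewrite -big_filter (eq_filter pE) (filter_pred1_uniq us es) big_seq1.
  by rewrite !one.
have none (F : E -> R) : \prod_(e <- s | choice.pickle e == n) F e = 1.
  by rewrite big_seq_cond big1// => e /andP[/s_n/negbTE ->].
by rewrite !none !mulr1 q_sum.
Qed.

Definition is_cylinder : set (set (E -> bool)) :=
  [set A | exists n, depends_below n A].

Definition mass A : R := expect (xget 0%N [set n | depends_below n A]) \1_A.

Lemma depends_below_indic n A :
  depends_below n A -> depends_below n (\1_A : _ -> R).
Proof.
move=> An w w' /An ww'; rewrite !indicE; congr (_%:R).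
by congr nat_of_bool; apply/idP/idP; rewrite !inE ww'.
Qed.

Lemma massE n A : depends_below n A -> mass A = expect n \1_A.
Proof.
move=> An; rewrite /mass; case: xgetP => [m _ Am|/(_ n)]; last by move/(_ An).
have [mn|/ltnW nm] := leqP m n.
  by rewrite (@expect_stable m n)//; exact: depends_below_indic.
by rewrite (@expect_stable n m)//; exact: depends_below_indic.
Qed.

Lemma is_cylinderU : setU_closed is_cylinder.
Proof.
move=> A B [m Am] [n Bn]; exists (maxn m n) => w w' ww'; rewrite /setU/mkset.
rewrite (depends_below_le (leq_maxl m n) Am ww').
by rewrite (depends_below_le (leq_maxr m n) Bn ww').
Qed.

Lemma is_cylinderC : setC_closed is_cylinder.
Proof.
by move=> A [m Am]; exists m => w w' ww'; rewrite /setC/mkset (Am _ _ ww').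
Qed.

Lemma is_cylinder0 : is_cylinder set0.
Proof. by exists 0%N. Qed.

Lemma mass_ge0 A : 0 <= mass A.
Proof.
rewrite /mass; set n := xget _ _; rewrite -(@expect_cst n 0).
by apply: expect_le => w; rewrite indicE.
Qed.

Lemma mass0 : mass set0 = 0.
Proof. by rewrite (@massE 0%N)//= indic0. Qed.

Lemma massT : mass setT = 1.
Proof. by rewrite (@massE 0%N)//= indicT. Qed.

Lemma mass_bigsetU_le N A (F : nat -> set (E -> bool)) :
    is_cylinder A -> (forall k, is_cylinder (F k)) ->
    A `<=` \bigcup_(k < N) F k ->
  mass A <= \sum_(k < N) mass (F k).
Proof.
move=> [m Am] cF AF.
have [n [mn Fn]] : exists n, (m <= n)%N /\
    forall k, (k < N)%N -> depends_below n (F k).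
  elim: N {AF} => [|N [n [mn IH]]]; first by exists m.
  have [p Fp] := cF N; exists (maxn n p); split.
    exact: (leq_trans mn (leq_maxl _ _)).
  move=> k; rewrite ltnS leq_eqVlt => /orP[/eqP ->|/IH].
    exact: (depends_below_le (leq_maxr _ _)).
  exact: (depends_below_le (leq_maxl _ _)).
rewrite (massE (depends_below_le mn Am)).
rewrite (eq_bigr (fun k : 'I_N => expect n \1_(F k))); last first.
  by move=> k _; exact/massE/Fn.
have <- : expect n (fun w => \sum_(k < N) \1_(F k) w) =
          \sum_(k < N) expect n \1_(F k).
  elim: N {AF Fn} => [|N IH].
    by rewrite big_ord0 -[RHS](expect_cst n); congr expect;
      apply/funext => w; rewrite big_ord0.
  rewrite big_ord_recr/= -IH -expectD; congr expect; apply/funext => w.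
  by rewrite big_ord_recr.
apply: expect_le => w; rewrite indicE; case: (boolP (w \in A)); last first.
  by move=> _; apply: sumr_ge0 => k _; rewrite indicE.
rewrite inE => /AF[k /= kN Fkw]; rewrite (bigD1 (Ordinal kN))//= indicE mem_set//.
by rewrite lerDl; apply: sumr_ge0 => j _; rewrite indicE.
Qed.

Lemma cylinder_compact A (F : nat -> set (E -> bool)) :
    is_cylinder A -> (forall k, is_cylinder (F k)) -> A `<=` \bigcup_k F k ->
  exists N, A `<=` \bigcup_(k < N) F k.
Proof.
move=> cA cF AF; apply: contrapT => /forallNP noN.
have /choice[u uP] N : exists w, A w /\ forall k, (k < N)%N -> ~ F k w.
  have /existsNP[w /not_implyP[Aw Fw]] := noN N.
  by exists w; split => // k kN Fkw; apply: Fw; exists k.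
have [U [UU ooU]] := ultraFilterLemma (eventually_filter : ProperFilter \oo).
pose w : E -> bool := fun e => `[< U [set N | u N e] >].
have wU e : U [set N | u N e = w e].
  rewrite /w; case: asboolP => [//|Ne].
  have [//|] := in_ultra_setVsetC [set N | u N e] UU.
  by apply: filterS => N /negP/negbTE.
have wUn n : U [set N | forall e, (choice.pickle e < n)%N -> u N e = w e].
  elim: n => [|n IH]; first exact: filterE.
  have [[e0 e0n]|none] := pselect (exists e : E, choice.pickle e = n); last first.
    move: IH; apply: filterS => N /= uw e.
    rewrite ltnS leq_eqVlt => /orP[/eqP en|]; last exact: uw.
    by case: none; exists e.
  apply: (filterS _ (filterI IH (wU e0))) => N [/= uw ue0] e.
  rewrite ltnS leq_eqVlt => /orP[/eqP en|]; last exact: uw.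
  by have -> : e = e0 by apply: (pcan_inj (@choice.pickleK E)); rewrite en.
have Aw : A w.
  have [n An] := cA; have [N /= uw] := filter_ex (wUn n).
  by rewrite -(An _ _ uw); have [] := uP N.
have [k _ Fkw] := AF _ Aw; have [n Fn] := cF k.
have /ooU Uk : \oo [set N | (k < N)%N] by exact: nbhs_infty_gt.
have [N [/= uw kN]] := filter_ex (filterI (wUn n) Uk).
by have [_ /(_ k kN)] := uP N; apply; rewrite (Fn _ _ uw).
Qed.

End Existence.

Fact cylinder_display : measure_display. Proof. by []. Qed.

Definition cylinder_space (E : countType) : Type := E -> bool.
HB.instance Definition _ (E : countType) := Pointed.on (cylinder_space E).
HB.instance Definition _ (E : countType) :=
  isAlgebraOfSets.Build cylinder_display (cylinder_space E)
    (@is_cylinder0 E) (@is_cylinderU E) (@is_cylinderC E).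

Section Extension.
Context (R : realType) (E : countType) (Q : probability bool R).

Definition cylinder_measure (A : set (cylinder_space E)) : \bar R :=
  (mass Q A)%:E.

Let cylinder_measure_ge0 A : (0 <= cylinder_measure A)%E.
Proof. by rewrite lee_fin mass_ge0. Qed.

Let cylinder_measure_additive : measure_function.semi_additive cylinder_measure.
Proof.
apply/additive2P; first by rewrite /cylinder_measure mass0.
move=> A B [m Am] [n Bn] AB; rewrite /cylinder_measure -EFinD; congr EFin.
have mU := depends_below_le (leq_maxl m n) Am.
have nU := depends_below_le (leq_maxr m n) Bn.
have U : depends_below (maxn m n) (A `|` B).
  by move=> w w' ww'; rewrite /setU/mkset (mU _ _ ww') (nU _ _ ww').
rewrite (massE Q U) (massE Q mU) (massE Q nU) -expectD; congr expect.
apply/funext => w /=; rewrite !indicE in_setU.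
have [wA|_] := boolP (w \in A); have [wB|_] := boolP (w \in B);
  rewrite /= ?addr0 ?add0r//.
suff : (A `&` B) w by rewrite AB.
by split; exact/set_mem.
Qed.

HB.instance Definition _ := isContent.Build _ _ _ cylinder_measure
  cylinder_measure_ge0 cylinder_measure_additive.

Let cylinder_measure_subadditive :
  measurable_subset_sigma_subadditive cylinder_measure.
Proof.
move=> A F mF mA AF; have [N AFN] := cylinder_compact mA mF AF.
apply: (@le_trans _ _ (\sum_(0 <= k < N) cylinder_measure (F k))%E).
  rewrite big_mkord /cylinder_measure sumEFin lee_fin.
  exact: mass_bigsetU_le.
by apply: nneseries_lim_ge.
Qed.

HB.instance Definition _ := Content_SigmaSubAdditive_isMeasure.Build _ _ _
  cylinder_measure cylinder_measure_subadditive.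

Definition product_measure (A : set (config E)) : \bar R :=
  measure_extension cylinder_measure A.

Let measurable_cylinder_sigma (A : set (config E)) : measurable A ->
  (@measurable _ (cylinder_space E)).-sigma.-measurable A.
Proof.
apply: smallest_sub; first exact: sigma_algebra_measurable.
move=> _ [e _ <-]; apply: sub_sigma_algebra.
by exists (choice.pickle e).+1 => w w' ww'; rewrite /mkset ww'.
Qed.

Let product_measure0 : product_measure set0 = 0%E.
Proof. exact: (@measure0 _ _ _ (measure_extension cylinder_measure)). Qed.

Let product_measure_ge0 A : (0 <= product_measure A)%E.
Proof. exact: (@measure_ge0 _ _ _ (measure_extension cylinder_measure)). Qed.

Let product_measure_sigma_additive : semi_sigma_additive product_measure.
Proof.
move=> F mF tF mUF.
apply: (@measure_semi_sigma_additive _ _ _ (measure_extension cylinder_measure)) => //.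
- by move=> k; exact: measurable_cylinder_sigma.
- exact: measurable_cylinder_sigma.
Qed.

HB.instance Definition _ := isMeasure.Build _ _ _ product_measure
  product_measure0 product_measure_ge0 product_measure_sigma_additive.

Lemma product_measureE A : is_cylinder A -> product_measure A = (mass Q A)%:E.
Proof.
by move=> cA; rewrite /product_measure /measure_extension measurable_mu_extE.
Qed.

Let product_measureT : product_measure setT = 1%E.
Proof. by rewrite product_measureE ?massT//; exists 0%N. Qed.

HB.instance Definition _ :=
  @Measure_isProbability.Build _ _ _ product_measure product_measureT.

Lemma product_measureP :
  is_product_measure Q (product_measure : probability (config E) R).
Proof.
move=> F A.
have [n Fn] : exists n, forall e, e \in F -> (choice.pickle e < n)%N.
  exists (\max_(e <- enum_fset F) (choice.pickle e).+1)%N => e eF.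
  exact: (@leq_bigmax_seq _ (enum_fset F) xpredT (fun e => (choice.pickle e).+1)).
have dep : depends_below n [set w : E -> bool | forall e, e \in F -> A e (w e)].
  move=> w w' ww'; apply/propext; split=> H e eF; have := H e eF;
  by rewrite ww'//; exact: Fn.
rewrite /= product_measureE; last by exists n.
rewrite (massE Q dep).
pose h e b : R := \1_(A e) b.
have -> : \1_[set w : E -> bool | forall e, e \in F -> A e (w e)] =
    (fun w => \prod_(e <- enum_fset F | (choice.pickle e < n)%N) h e (w e)).
  apply/funext => w; rewrite indicE; case: (boolP (w \in _)).
    rewrite inE => /= Aw; rewrite big_seq_cond big1// => e /andP[eF _].
    by rewrite /h indicE mem_set//; exact: Aw.
  rewrite notin_setE => /= /existsNP[e /not_implyP[eF nAe]].
  rewrite -big_filter (big_rem e)/=; last by rewrite mem_filter Fn// eF.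
  by rewrite /h indicE memNset// mul0r.
rewrite expect_prod ?fset_uniq// -big_filter (all_filterP _); last first.
  by apply/allP => e; exact: Fn.
have QA e : Q (A e) = (fine (Q [set true]) * h e true +
                       fine (Q [set false]) * h e false)%:E.
  have Qb b : (fine (Q [set b]) * h e b)%:E = Q (A e `&` [set b]).
    rewrite /h indicE; case: (boolP (b \in A e)); rewrite ?inE ?notin_setE => Ab.
      rewrite mulr1 fineK ?fin_num_measure//; congr (Q _).
      by rewrite seteqP; split => [_ ->|? []].
    rewrite mulr0 (_ : _ `&` _ = set0) ?measure0//.
    by rewrite -subset0 => c [/[swap] ->].
  rewrite EFinD !Qb -measureU//.
    by rewrite -setIUr -setT_bool setIT.
  by rewrite -subset0 => c [[_ ->] []].
by rewrite -prodEFin; apply: eq_bigr => e _; rewrite QA.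
Qed.

End Extension.

Lemma bernoulli_productP (R : realType) (E : countType) (p : R) :
  is_product_measure (bernoulli_prob p) (bernoulli_product E p).
Proof.
rewrite /bernoulli_product; case: xgetP => [P _ //|/(_ (product_measure _))].
by move=> /(_ (bernoulli_prob p))[]; exact: product_measureP.
Qed.

Lemma product_measure_unique (R : realType) (E : choiceType)
    (Q : probability bool R) (P1 P2 : probability (config E) R) :
    is_product_measure Q P1 -> is_product_measure Q P2 ->
  forall X, measurable X -> P1 X = P2 X.
Proof.
move=> P1Q P2Q.
pose box (F : {fset E}) (A : E -> set bool) : set (config E) :=
  [set w | forall e, e \in F -> A e (w e)].
pose G : set (set (config E)) := [set X | exists F A, X = box F A].
have mG : @measurable _ (config E) = <<s G >>.
  rewrite eqEsubset; split; apply: smallest_sub.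
  - exact: smallest_sigma_algebra.
  - move=> _ [e _ <-]; apply: sub_sigma_algebra.
    exists [fset e]%fset, (fun=> [set true]); apply/seteqP; split => w /=.
      by move=> we e'; rewrite in_fset1 => /eqP ->.
    by apply; rewrite fset11.
  - exact: sigma_algebra_measurable.
  - move=> _ [F [A ->]]; rewrite (_ : box F A = \bigcap_(e in [set` F])
      ((fun w : config E => w e) @^-1` A e)).
      apply: fin_bigcap_measurable => [|e _]; first exact: finite_fset.
      rewrite -[X in measurable X]setTI.
      suff : measurable_fun setT (fun w : config E => w e) by exact.
      apply: (measurable_fun_bool true); rewrite setTI.
      by apply: sub_sigma_algebra; exists e.
    by apply/seteqP; split => w H e; exact: H.
apply: (@measure_unique _ _ _ G (fun=> setT)) => //.
- move=> _ _ [F1 [A1 ->]] [F2 [A2 ->]].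
  exists (F1 `|` F2)%fset.
  exists (fun e => [set b | (e \in F1 -> A1 e b) /\ (e \in F2 -> A2 e b)]).
  apply/seteqP; split => w /=.
    by move=> [w1 w2] e _; split => [/w1|/w2].
  by move=> ww; split => e eF; have [] := ww e; rewrite ?in_fsetU ?eF ?orbT//; auto.
- by move=> _; exists fset0, (fun=> setT); apply/seteqP; split.
- by rewrite bigcup_const.
- by move=> _ [F [A ->]]; exact: (etrans (P1Q F A) (esym (P2Q F A))).
- by move=> _; exact: (le_lt_trans (probability_le1 P1 measurableT) (ltry 1)).
Qed.

Definition vertex (d : nat) := 'rV[int]_d.

Definition adjacent (d : nat) (x y : vertex d) : bool :=
  \sum_(i < d) `|x ord0 i - y ord0 i| == 1.

Definition edge (d : nat) :=
  {A : {fset vertex d} |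
     `[< exists x y : vertex d, adjacent x y /\ A = [fset x; y]%fset >]}.

Definition shielded (d : nat) (w : config (edge d)) (x : vertex d) : Prop :=
  forall e : edge d, x \in val e -> w e = false.

(* The edges of a path are determined by its successive vertices. *)
Definition has_infinite_shielded_path (d : nat) (w : config (edge d)) : Prop :=
  exists v : nat -> vertex d,
    [/\ injective v, forall n, adjacent (v n) (v n.+1)
      & forall n, shielded w (v n)].

Definition p_shield (R : realType) (d : nat) : R :=
  sup [set p : R | 0 <= p <= 1 /\
    (0 < bernoulli_product (edge d) p
           [set w | has_infinite_shielded_path w])%E].

(* n counts vertices, not steps. *)
Definition self_avoiding_paths (d n : nat) : set (seq (vertex d)) :=
  [set s | [/\ size s = n, ohead s = Some 0, sorted (@adjacent d) s & uniq s]].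
Arguments self_avoiding_paths : clear implicits.

Lemma finite_self_avoiding_paths (d n : nat) :
  finite_set (self_avoiding_paths d n).
Proof.
pose step (t : {ffun 'I_d -> 'I_3}) : vertex d := \row_i ((t i)%:Z - 1).
have adj x y : adjacent x y -> exists t, y = x + step t.
  move=> /eqP xy; have le1 i : `|x ord0 i - y ord0 i| <= 1.
    by rewrite -xy (bigD1 i)//= lerDl sumr_ge0.
  exists [ffun i => inord `|(y ord0 i - x ord0 i + 1)%R|%N].
  apply/rowP => i; rewrite !mxE ffunE; move: (le1 i).
  move: (x ord0 i) (y ord0 i) => a b ab.
  have sm : (`|(b - a + 1)%R|%N < 3)%N by lia.
  by rewrite inordK//; lia.
have fin m x : finite_set [set s | path (@adjacent d) x s /\ size s = m].
  elim: m x => [|m IH] x.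
    by apply: (@sub_finite_set _ _ [set [::]]) => // s [_ /size0nil].
  apply: (@sub_finite_set _ _ (\bigcup_(t in [set: {ffun 'I_d -> 'I_3}])
    (cons (x + step t) @`
       [set s | path (@adjacent d) (x + step t) s /\ size s = m]))).
    move=> [[_ //]|y s [/= /andP[/adj[t ->] ps] [sm]]].
    by exists t => //; exists s.
  by apply: bigcup_finite => [|t _]; [exact: finite_finset|exact/finite_image].
apply: (@sub_finite_set _ _ ([set [::]] `|` cons 0 @`
    [set s | path (@adjacent d) 0 s /\ size s = n.-1])).
  case=> [|x s] [/= sn]; first by left.
  by move=> [->] ps _; right; exists s => //; split => //; rewrite -sn.
by rewrite finite_setU; split; [exact: finite_set1|exact/finite_image].
Qed.

Definition connective_constant (R : realType) (d : nat) : R :=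
  limn (fun n =>
    (#|` fset_set (self_avoiding_paths d n)|%fset)%:R `^ n%:R^-1 : R).

(* Main.v *)
Require Import Defs.
From mathcomp Require Import all_boot all_order all_algebra finmap.
From mathcomp Require Import all_classical all_reals all_analysis.
From mathcomp Require Import zify lra ring.
Set Implicit Arguments.
Unset Strict Implicit.
Unset Printing Implicit Defensive.
Import Order.TTheory GRing.Theory Num.Theory.
Import numFieldNormedType.Exports.
Local Open Scope classical_set_scope.
Local Open Scope ring_scope.

(** The idea is that an infinite shielded path can be replaced by a chordless
one, and that a chordless path of n vertices forces many edges to be closed.

Among the shielded vertices, a walk can be shortcut along its chords until
no two non-consecutive vertices are neighbors ([chordless_path_in]).
Applied to longer and longer pieces of an infinite shielded path from x, this
gives chordless shielded paths from x with any number n of vertices. Each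
vertex of such a path has 2d edges, and an edge is shared by two vertices of
the path only when they are consecutive, so that at least (2d-1)n distinct
edges are closed ([chordless_edges]); without chordlessness there could be
only about dn of them. A union bound over the c_n self-avoiding paths of n
vertices yields a probability of at most c_n (1-p)^((2d-1)n), by
[prob_chordless_shielded_le]. As c_n^(1/n) tends to the connective constant
lambda, this tends to 0 as soon as lambda (1-p)^(2d-1) < 1, which is
p > 1 - lambda^(-1/(2d-1)); there are countably many starting points x, so
almost surely no infinite shielded path exists.

Two further points need an argument. The limit defining lambda exists: the
numbers c_(n+1) are submultiplicative ([card_saw_submul]), and Fekete's lemma
applies to their logarithms ([fekete], [connective_constant_cvg]). And the
existence of an infinite shielded path is a measurable event, so that a
bound on the finite events says something about its probability: by
compactness it is the countable union over x, of the countable intersection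
over n, of the events that x starts a chordless shielded path of n vertices
([has_infinite_shielded_pathE]). *)

(* Unqualified, this name would denote pairs of adjacent real sequences. *)
Local Notation adjacent := Defs.adjacent.

(** * Chordless paths in a graph *)

Section Chordless.
Context (T : eqType) (e : rel T).

(** The successor of x is skipped by [behead]: only edges to later vertices
are chords. *)
Fixpoint chordless (s : seq T) : bool :=
  if s is x :: s' then all (fun y => ~~ e x y) (behead s') && chordless s'
  else true.

Lemma chordless_catr s1 s2 : chordless (s1 ++ s2) -> chordless s2.
Proof. by elim: s1 => //= x s1 IH /andP[_]. Qed.

Lemma chordless_take n s : chordless s -> chordless (take n s).
Proof.
elim: s n => [|x s IH] [|n] //= /andP[xs cs]; rewrite IH// andbT.
apply/allP => y yt; apply: (allP xs).
case: s {xs cs IH} yt => [|z s]; case: n => [|n] //=; exact: mem_take.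
Qed.

Lemma split_last_has (a : pred T) s : has a s ->
  exists s1 z s2, [/\ s = s1 ++ z :: s2, a z & ~~ has a s2].
Proof.
elim: s => //= y s IH.
have [/IH[s1 [z [s2 [-> az s2a]]]] _|sa] := boolP (has a s).
  by exists (y :: s1), z, s2.
by rewrite orbF => ay; exists [::], y, s.
Qed.

(** A walk is made chordless from its end: given a chordless path for the
tail, the first vertex x is joined to the last vertex of it that is a
neighbor of x, or, if x lies on it already, the path is cut at x. *)
Lemma chordless_path_in x p : path e x p ->
  exists q, [/\ path e x q, last x q = last x p, uniq (x :: q),
    chordless (x :: q) & {subset x :: q <= x :: p}].
Proof.
elim: p x => [|y p IH] x /=; first by move=> _; exists [::]; split.
move=> /andP[xy /IH[q [yq lq uq cq sq]]].
have sub : {subset y :: q <= x :: y :: p}.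
  by move=> z /sq zp; rewrite inE zp orbT.
have [xq|xNq] := boolP (x \in y :: q).
  have sq' : sorted e (y :: q) by [].
  have lq' : last x (y :: q) = last y p by [].
  case/splitPr: xq uq cq sub sq' lq' => q1 q2; rewrite cat_uniq.
  move=> /and3P[_ _ uq] cq sub /cat_sorted2[_ sq'] lq'; exists q2; split => //.
  - by move: lq'; rewrite last_cat.
  - exact: chordless_catr cq.
  - by move=> z zq; apply: sub; rewrite mem_cat zq orbT.
have /split_last_has[q1 [z [q2 [qE xz nq2]]]] : has (e x) (y :: q).
  by rewrite /= xy.
have sq' : sorted e (y :: q) by [].
have lq' : last x (y :: q) = last y p by [].
rewrite qE in uq cq sub sq' xNq lq'.
exists (z :: q2); split.
- by rewrite /= xz; have [_] := cat_sorted2 sq'.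
- by move: lq'; rewrite last_cat.
- move: uq xNq; rewrite cat_uniq mem_cat negb_or => /and3P[_ _ uq] /andP[_ xz2].
  by apply/andP.
- by apply/andP; split; [rewrite all_predC|exact: chordless_catr cq].
- move=> t; rewrite inE => /predU1P[->|tq]; first by rewrite inE eqxx.
  by apply: sub; rewrite mem_cat tq orbT.
Qed.

End Chordless.

(** * Edges touching a chordless path *)

Section Edges.
Context (d : nat).
Implicit Types (x y : vertex d) (s : seq (vertex d)).

Definition step (t : 'I_d * bool) : vertex d :=
  (-1) ^+ t.2 *: delta_mx ord0 t.1.

Lemma step_entry t i : step t ord0 i = if i == t.1 then (-1) ^+ t.2 else 0.
Proof.
by rewrite !mxE eqxx /=; case: eqP => _; rewrite ?mulr1 ?mulr0.
Qed.

Lemma step_inj : injective step.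
Proof.
move=> [i b] [j c] /rowP bc; have := bc i; rewrite !step_entry/= eqxx.
by case: eqP => [<-|_]; case: (b); case: (c).
Qed.

Lemma adjacent_addr z x y : adjacent (x + z) (y + z) = adjacent x y.
Proof.
by rewrite /adjacent; congr (_ == _); apply: eq_bigr => i _;
  rewrite !mxE opprD addrACA subrr addr0.
Qed.

Lemma adjacent_step x t : adjacent x (x + step t).
Proof.
rewrite /adjacent (bigD1 t.1)//= big1 => [|i it].
  rewrite mxE step_entry eqxx opprD addrA subrr sub0r normrN addr0.
  by case: t => i [].
by rewrite mxE step_entry (negbTE it) addr0 subrr normr0.
Qed.

Lemma adjacent_irr x : adjacent x x = false.
Proof. by rewrite /adjacent big1// => i _; rewrite subrr normr0. Qed.

Fact edge_at_subproof x t : `[< exists y z : vertex d,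
  adjacent y z /\ [fset x; (x + step t)%R]%fset = [fset y; z]%fset >].
Proof. by apply/asboolP; exists x, (x + step t); rewrite adjacent_step. Qed.

Definition edge_at x t : edge d := 
  exist (fun A : {fset vertex d} => is_true `[< exists y z : vertex d,
    adjacent y z /\ A = [fset y; z]%fset >]) _ (edge_at_subproof x t).

Lemma edge_at_inj x : injective (edge_at x).
Proof.
move=> t u tu; have : x + step t \in val (edge_at x u).
  by rewrite -tu in_fset2 eqxx orbT.
rewrite in_fset2 => /predU1P[xt|/eqP/addrI/step_inj//].
by have := adjacent_step x t; rewrite xt adjacent_irr.
Qed.

(** Adding a vertex x in front of s touches the 2d edges at x. Those that
lead outside of s are new, and by chordlessness the only one that may lead
into s is the edge to the head of s. *)
Lemma chordless_edges s : chordless (@adjacent d) s -> uniq s ->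
  exists L : seq (edge d), [/\ uniq L,
    forall f, f \in L -> exists2 x, x \in s & x \in val f
    & ((2 * d - 1) * size s <= size L)%N].
Proof.
elim: s => [|x s IH] /=; first by exists [::]; rewrite muln0; split.
move=> /andP[xs cs] /andP[xNs us]; have [L [uL Ls sL]] := IH cs us.
pose N := [seq t <- enum {: 'I_d * bool} | x + step t \notin s].
exists (map (edge_at x) N ++ L); split.
- rewrite cat_uniq uL (map_inj_uniq (@edge_at_inj x)) filter_uniq ?enum_uniq//.
  rewrite andbT; apply/hasPn => f /Ls[y ys yf]; apply/negP => /mapP[t].
  rewrite mem_filter => /andP[ts _] ft; move: yf; rewrite ft in_fset2.
  by case/predU1P => [yx|/eqP yx]; [move: xNs|move: ts]; rewrite -yx ys.
- move=> f; rewrite mem_cat => /orP[/mapP[t _ ->]|/Ls[y ys yf]].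
    by exists x; rewrite ?inE ?eqxx.
  by exists y => //; rewrite inE ys orbT.
- rewrite size_cat size_map mulnS; apply: leq_add sL.
  have := count_predC (fun t => x + step t \in s) (enum {: 'I_d * bool}).
  rewrite -cardE card_prod card_ord card_bool /N size_filter => dE.
  have -> : count (fun t => x + step t \notin s) (enum {: 'I_d * bool}) =
    count (predC (fun t => x + step t \in s)) (enum {: 'I_d * bool}) by [].
  (* At most one direction t leads from x into s. *)
  rewrite leq_subLR mulnC -dE leq_add2r.
  case: s xs {IH cs xNs us Ls dE N} => [|y s] xs.
    by rewrite (eq_count (a2 := pred0)) ?count_pred0// => t.
  apply: (@leq_trans (count (fun t => x + step t == y) (enum {: 'I_d * bool}))).
    apply: sub_count => t; rewrite inE => /orP[//|/(allP xs)].
    by rewrite adjacent_step.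
  rewrite -(count_map (fun t => x + step t) (pred1 y)) count_uniq_mem ?leq_b1//.
  by rewrite map_inj_uniq ?enum_uniq// => t u /addrI/step_inj.
Qed.

End Edges.

(** * Infinite shielded paths and their finite prefixes *)

Section Paths.
Context (d : nat).
Implicit Types (x y z : vertex d) (s : seq (vertex d)) (n : nat).

Definition saw_from x n : set (seq (vertex d)) :=
  [set s | [/\ size s = n, ohead s = Some x, sorted (@adjacent d) s & uniq s]].

Definition translate z s := map (fun y => y + z) s.

Lemma translateK z : cancel (translate z) (translate (- z)).
Proof.
by move=> s; rewrite /translate -map_comp map_id_in// => y _ /=; rewrite addrK.
Qed.

Lemma saw_from_translate z x n s :
  saw_from x n s -> saw_from (x + z) n (translate z s).
Proof.
move=> [sn sx ss us]; split; first by rewrite size_map.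
- by case: s sx {sn ss us} => //= a s [->].
- rewrite sorted_map; apply: sub_sorted ss => a b /=.
  by rewrite adjacent_addr.
- by rewrite map_inj_uniq// => a b /addIr.
Qed.

Lemma saw_from_image x n :
  saw_from x n `<=` translate x @` self_avoiding_paths d n.
Proof.
move=> s /(saw_from_translate (- x)); rewrite subrr => sx.
by exists (translate (- x) s) => //; rewrite -{1}(opprK x) translateK.
Qed.

Lemma finite_saw_from x n : finite_set (saw_from x n).
Proof.
apply: (sub_finite_set (@saw_from_image x n)).
exact/finite_image/finite_self_avoiding_paths.
Qed.

Lemma card_saw_from x n :
  (#|` fset_set (saw_from x n)| <= #|` fset_set (self_avoiding_paths d n)|)%N.
Proof.
rewrite -[leqRHS](size_map (translate x)); apply: uniq_leq_size => [|s].
  exact: fset_uniq.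
rewrite in_fset_set ?inE; last exact: finite_saw_from.
move=> /saw_from_image[t ts <-]; apply: map_f.
by rewrite in_fset_set ?inE//; exact: finite_self_avoiding_paths.
Qed.

Definition chordless_shielded x n : set (config (edge d)) :=
  [set w | exists s, [/\ saw_from x n s, chordless (@adjacent d) s &
                         forall y, y \in s -> shielded w y]].

(** The pigeonhole principle along an ultrafilter. *)
Lemma ultra_finite_cst (T : Type) (U : choiceType) (F : set_system T)
    (A : set U) (f : T -> U) :
    UltraFilter F -> finite_set A -> F (f @^-1` A) ->
  exists a, F [set t | f t = a].
Proof.
move=> UF fA FA; apply: contrapT => /forallNP noa.
have FC a : F [set t | f t <> a].
  by have [/noa//|] := in_ultra_setVsetC [set t | f t = a] UF.
have Fn : F (\bigcap_(a in [set` fset_set A]) [set t | f t <> a]).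
  by apply: filter_bigI => a _; exact: FC.
have [t [At /(_ (f t))]] := filter_ex (filterI FA Fn); apply=> //=.
by rewrite in_fset_set// inE.
Qed.

(** The chordless reduction of the first N steps of an infinite path v still
ends at v N. It may be short for some N, but not for all: there are finitely
many short self-avoiding paths from v 0, hence finitely many endpoints, while
the vertices v N are distinct. *)
Lemma infinite_shielded_path_prefixes w :
  has_infinite_shielded_path w ->
  exists x, forall n, chordless_shielded x n.+1 w.
Proof.
move=> [v [vinj vadj vsh]]; exists (v 0%N) => n.
have vp N : path (@adjacent d) (v 0%N) (map (v \o S) (iota 0 N)).
  rewrite -[path _ _ _]/(sorted (@adjacent d) (v 0%N :: _)).
  have -> : v 0%N :: map (v \o S) (iota 0 N) = map v (iota 0 N.+1).
    by rewrite /= (iotaDl 1 0) -map_comp.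
  apply/(sortedP (v 0%N)) => i; rewrite size_map size_iota => iN.
  by rewrite !(nth_map 0%N) ?size_iota ?(ltnW iN)// !nth_iota ?(ltnW iN).
have /choice[q qP] N := chordless_path_in (vp N).
have vl N : last (v 0%N) (map (v \o S) (iota 0 N)) = v N.
  by case: N => // N; rewrite -[in iota _ _]addn1 iotaD map_cat last_cat.
have [N nN] : exists N, (n <= size (q N))%N.
  apply: contrapT => /forallNP noN.
  pose B := \bigcup_(k in `I_n) (last (v 0%N) @` saw_from (v 0%N) k.+1).
  have fB : finite_set B.
    by apply: bigcup_finite => // k _; exact/finite_image/finite_saw_from.
  have : finite_set (v @^-1` B).
    by apply: finite_preimage => // i j _ _; exact: vinj.
  suff -> : v @^-1` B = setT by exact: infinite_nat.
  apply/seteqP; split => // N _ /=; have [qp ql qu _ _] := qP N.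
  exists (size (q N)); first by rewrite /= ltnNge; apply/negP/noN.
  by exists (v 0%N :: q N) => //=; rewrite ql vl.
have [qp ql qu qc qs] := qP N.
exists (take n.+1 (v 0%N :: q N)); split.
- split=> //; first by rewrite /= size_takel.
  + by rewrite /=; exact: take_path.
  + exact: take_uniq.
- exact: chordless_take.
- move=> y /mem_take/qs; rewrite inE => /predU1P[->//|/mapP[k _ ->]].
  exact: vsh.
Qed.

(** Koenig's lemma for shielded paths. Since the k-th vertex of a
self-avoiding path from x takes finitely many values, it is constant along an
ultrafilter on the lengths N of the given paths s N; the limit path v consists
of these constants. Any two vertices of v are realized simultaneously by some
s N, which gives all properties of v. *)
Lemma infinite_shielded_path_limit w x :
  (forall n, chordless_shielded x n.+1 w) -> has_infinite_shielded_path w.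
Proof.
move=> /choice[s sP].
have [U [UU ooU]] := ultraFilterLemma (eventually_filter : ProperFilter \oo).
have Ugt k : U [set N | (k < N)%N] by apply: ooU; exact: nbhs_infty_gt.
have /choice[v vP] k : exists a, U [set N | nth x (s N) k = a].
  apply: (@ultra_finite_cst _ _ _ ((fun t => nth x t k) @` saw_from x k.+1)).
    exact/finite_image/finite_saw_from.
  apply: filterS (Ugt k) => N /= kN; have [[sz hd so un] _ _] := sP N.
  exists (take k.+1 (s N)); last by rewrite nth_take.
  split; first by rewrite size_takel// sz ltnS ltnW.
  - by case: (s N) hd.
  - exact: take_sorted.
  - exact: take_uniq.
have agree i j : exists N, [/\ nth x (s N) i = v i, nth x (s N) j = v j,
    (i < size (s N))%N & (j < size (s N))%N].
  have [N [[vi vj] [iN jN]]] :=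
    filter_ex (filterI (filterI (vP i) (vP j)) (filterI (Ugt i) (Ugt j))).
  have [[sz _ _ _] _ _] := sP N.
  by exists N; split; rewrite // sz ltnW.
exists v; split.
- move=> i j vij; have [N [vi vj iN jN]] := agree i j.
  have [[_ _ _ un] _ _] := sP N.
  by apply/eqP; rewrite -(nth_uniq x iN jN un) vi vj vij.
- move=> n; have [N [<- <- _ nN]] := agree n n.+1.
  have [[_ _ so _] _ _] := sP N; exact: (sortedP x).
- move=> n; have [N [<- _ nN _]] := agree n n.
  by have [_ _ sh] := sP N; apply: sh; exact: mem_nth.
Qed.

End Paths.

(** * Measurability *)

Section Measurability.
Context (d : nat).
Implicit Types (x : vertex d) (n : nat).

Lemma measurable_closed (f : edge d) :
  measurable ([set w | w f = false] : set (config (edge d))).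
Proof.
rewrite (_ : mkset _ = ~` [set w : config (edge d) | w f]).
  by apply: measurableC; apply: sub_sigma_algebra; exists f.
by apply/seteqP; split => w /= => [->|/negP/negbTE].
Qed.

Lemma measurable_shielded x :
  measurable ([set w | shielded w x] : set (config (edge d))).
Proof.
pose F (e : edge d) := [set w : config (edge d) | x \in val e /\ w e].
have mF e : measurable (F e).
  have [xe|xNe] := boolP (x \in val e); last first.
    have -> : F e = set0.
      by apply/seteqP; split => // w []; rewrite (negbTE xNe).
    exact: measurable0.
  have -> : F e = ~` [set w | w e = false].
    apply/seteqP; split => w /=; first by move=> [_ ->].
    by move=> /eqP; rewrite eqbF_neg negbK.
  by apply: measurableC; exact: (measurable_closed e).
have -> : [set w | shielded w x] = ~` \bigcup_e F e.
  apply/seteqP; split => w /=; first by move=> wx [e _ [/wx ->]].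
  by move=> nw e xe; apply/negbTE/negP => we; apply: nw; exists e.
exact: (measurableC (countable_bigcupT_measurable (countableP _) mF)).
Qed.

Lemma measurable_all_shielded (s : seq (vertex d)) :
  measurable ([set w | forall y, y \in s -> shielded w y]
    : set (config (edge d))).
Proof.
elim: s => [|x s IH].
  by rewrite (_ : mkset _ = setT)//; apply/seteqP; split.
rewrite (_ : mkset _ = [set w | shielded w x] `&`
    [set w | forall y, y \in s -> shielded w y]).
  by apply: measurableI => //; exact: measurable_shielded.
apply/seteqP; split => w /=.
  by move=> sw; split=> [|y ys]; apply: sw; rewrite inE ?eqxx// ys orbT.
by move=> [wx ws] y; rewrite inE => /predU1P[->//|]; exact: ws.
Qed.

Lemma measurable_chordless_shielded x n :
  measurable (chordless_shielded x n).
Proof.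
pose F s := [set w : config (edge d) |
  (saw_from x n s /\ chordless (@adjacent d) s) /\
  forall y, y \in s -> shielded w y].
have mF s : measurable (F s).
  have [sP|sNP] := pselect (saw_from x n s /\ chordless (@adjacent d) s).
    have -> : F s = [set w | forall y, y \in s -> shielded w y].
      by apply/seteqP; split => w //= [].
    exact: measurable_all_shielded.
  by have -> : F s = set0 by apply/seteqP; split => // w [].
have -> : chordless_shielded x n = \bigcup_s F s.
  apply/seteqP; split => w [s]; first by move=> [? ? ?]; exists s.
  by move=> _ [[? ?] ?]; exists s.
exact: (countable_bigcupT_measurable (countableP _) mF).
Qed.

Lemma has_infinite_shielded_pathE :
  [set w : config (edge d) | has_infinite_shielded_path w] =
  \bigcup_x \bigcap_n chordless_shielded x n.+1.
Proof.
apply/seteqP; split => w /=.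
  by move=> /infinite_shielded_path_prefixes[x wx]; exists x.
move=> [x _ wx]; apply: (infinite_shielded_path_limit (x := x)) => n.
exact: wx.
Qed.

End Measurability.

(** * The union bound *)

Section Probability.
Context (R : realType) (d : nat) (p : R) (p01 : 0 <= p <= 1).
Let P := bernoulli_product (edge d) p.

Lemma prob_all_closed (L : seq (edge d)) : uniq L ->
  P [set w | forall f, f \in L -> w f = false] = ((1 - p) ^+ size L)%:E.
Proof.
move=> uL.
have := @bernoulli_productP R (edge d) p [fset f in L]%fset (fun=> [set false]).
rewrite (_ : mkset _ = [set w | forall f, f \in L -> w f = false]); last first.
  by apply/seteqP; split => w /= wL f fL; apply: wL; move: fL; rewrite inE.
have closed_prob : bernoulli_prob p [set false] = (1 - p)%:E.
  rewrite bernoulli_probE// !diracE.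
  by rewrite [false \in _]mem_set// [true \in _]memNset// mule0 add0e mule1.
move=> ->; rewrite (eq_bigr (fun=> (1 - p)%:E)) => [|f _]; last first.
  exact: closed_prob.
rewrite prodEFin big_const_seq count_predT iter_mulr_1.
by rewrite card_fseq undup_id.
Qed.

Lemma prob_all_shielded_le (s : seq (vertex d)) :
    chordless (@adjacent d) s -> uniq s ->
  (P [set w | forall y, y \in s -> shielded w y]
    <= ((1 - p) ^+ ((2 * d - 1) * size s))%:E)%E.
Proof.
move=> cs us; have [L [uL Ls sL]] := chordless_edges cs us.
apply: (@le_trans _ _ (P [set w | forall f, f \in L -> w f = false])).
  apply: le_measure; rewrite ?inE; first exact: measurable_all_shielded.
    apply: (@fin_bigcap_measurable _ _ _ [set` L]) => // f _.
    exact: measurable_closed.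
  by move=> w ws f /Ls[x xs xf]; exact: ws xf.
rewrite prob_all_closed// lee_fin; have /andP[p0 p1] := p01.
by apply: ler_wiXn2l => //; lra.
Qed.

Lemma prob_chordless_shielded_le x n :
  (P (chordless_shielded x n) <=
  (#|` fset_set (self_avoiding_paths d n)|%:R *
   (1 - p) ^+ ((2 * d - 1) * n))%:E)%E.
Proof.
pose D := saw_from x n `&` [set s | chordless (@adjacent d) s].
have fD : finite_set D.
  by apply: (sub_finite_set (@subIsetl _ _ _)); exact: finite_saw_from.
have := @content_sub_fsum _ _ _ P _ D (chordless_shielded x n)
  (fun s => [set w | forall y, y \in s -> shielded w y]) fD
  (fun s _ => measurable_all_shielded s) (measurable_chordless_shielded x n).
move=> /(_ _)/le_trans; apply.
  by move=> w [s [sx cs ws]]; exists s.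
rewrite fsbig_finite//=.
apply: (@le_trans _ _ (\sum_(s <- fset_set D)
    ((1 - p) ^+ ((2 * d - 1) * n))%:E)%E).
  rewrite big_seq [leRHS]big_seq; apply: lee_sum => s.
  rewrite in_fset_set// inE => -[[<- _ _ us] cs].
  exact: prob_all_shielded_le.
rewrite sumEFin lee_fin big_const_seq count_predT iter_addr_0 -[leLHS]mulr_natl.
apply: ler_wpM2r; first by have /andP[_ p1] := p01; apply: exprn_ge0; lra.
rewrite ler_nat; apply: leq_trans (card_saw_from x n); apply: fsubset_leq_card.
rewrite -fset_set_sub//; [exact: subIsetl|exact: finite_saw_from].
Qed.

End Probability.

(** * The connective constant is a limit *)

Section Fekete.
Context (R : realType) (u : nat -> R) (u_ge0 : forall n, 0 <= u n)
  (u_sub : forall m n, u (m + n)%N <= u m + u n).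

Lemma subadditive_muln q m r : u (q * m + r)%N <= q%:R * u m + u r.
Proof.
elim: q => [|q IH]; first by rewrite mul0n add0n mul0r add0r.
rewrite mulSn -addnA (le_trans (u_sub _ _))// -natr1 mulrDl mul1r.
by move: IH; lra.
Qed.

(** If m nearly attains the infimum L of u m / m, then dividing n by m gives
u n <= n (u m / m) + M, where M bounds u on all remainders; hence u n / n is
at most L + eps for n large. *)
Lemma fekete :
  u n / n%:R @[n --> \oo] --> inf [set u n.+1 / n.+1%:R | n in setT].
Proof.
set E := [set _ | _ in _].
have E0 : has_lbound E by exists 0 => _ [n _ <-]; rewrite divr_ge0.
have hE : has_inf E by split => //; exists (u 1%N / 1%:R); exists 0%N.
apply/cvgrPdist_lt => eps eps0; have eps2 : 0 < eps / 2 by rewrite divr_gt0.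
have [_ [k _ <-] kL] := inf_adherent eps2 hE.
set m := k.+1 in kL; set M := \sum_(r < m) u r.
near=> n.
have n0 : (0 < n)%N by near: n; exact: nbhs_infty_gt.
have nR : 0 < n%:R :> R by rewrite ltr0n.
have Mn : M / (eps / 2) < n%:R by near: n; exact: nbhs_infty_gtr.
have Ln : inf E <= u n / n%:R.
  by apply: ge_inf => //; exists n.-1 => //; rewrite prednK.
rewrite ler0_norm ?subr_le0// opprB ltrBlDl.
have uM : u (n %% m)%N <= M.
  have rm : (n %% m < m)%N by rewrite ltn_mod.
  by rewrite /M (bigD1 (Ordinal rm))//= lerDl sumr_ge0.
have un : u n <= n%:R * (u m / m%:R) + M.
  rewrite {1}(divn_eq n m) (le_trans (subadditive_muln _ _ _))// lerD//.
  rewrite mulrCA mulrC ler_wpM2l// ler_pdivlMr ?ltr0n//.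
  by rewrite -natrM ler_nat leq_trunc_div.
rewrite ltr_pdivrMr//; apply: le_lt_trans un _.
move: kL; rewrite -(ltr_pM2r nR) [_ * n%:R]mulrC.
move: Mn; rewrite ltr_pdivrMr//.
set a := u m / m%:R; set l := inf E; move=> *; nra.
Unshelve. all: by end_near. Qed.

End Fekete.

Section Connective.
Context (d : nat).

Let c n := #|` fset_set (self_avoiding_paths d n)|%fset.

(** A path of m + n steps is split at its vertex number m, which belongs to
both parts; the second part is translated back to the origin. The shift by
one comes from the count of vertices instead of steps. *)
Lemma card_saw_submul m n : (c (m + n).+1 <= c m.+1 * c n.+1)%N.
Proof.
pose glue (a b : seq (vertex d)) := take m a ++ translate (nth 0 a m) b.
pose S k := enum_fset (fset_set (self_avoiding_paths d k)).
have SE k s : (s \in S k) = (s \in self_avoiding_paths d k).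
  by rewrite in_fset_set//; exact: finite_self_avoiding_paths.
rewrite -[leqRHS](size_allpairs glue (S m.+1) (S n.+1)).
apply: uniq_leq_size => [|s]; first exact: fset_uniq.
rewrite -[_ \in _]/(s \in S _) SE inE => -[sz hd so un].
apply/allpairsP; exists (take m.+1 s, translate (- nth 0 s m) (drop m s)).
split => /=; rewrite ?SE ?inE.
- split; [by rewrite size_takel// sz ltnS leq_addr|by case: (s) hd| |].
  + exact: take_sorted.
  + exact: take_uniq.
- have := @saw_from_translate d (- nth 0 s m) (nth 0 s m) n.+1 (drop m s).
  rewrite subrr; apply; split.
  + by rewrite size_drop sz -addnS addKn.
  + by rewrite (drop_nth 0)// sz ltnS leq_addr.
  + exact: drop_sorted.
  + exact: drop_uniq.
- rewrite /glue nth_take// take_takel//.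
  by rewrite -{1}(opprK (nth 0 s m)) translateK cat_take_drop.
Qed.

(** A straight line is self-avoiding. *)
Lemma card_saw_gt0 n : (0 < d)%N -> (0 < c n.+1)%N.
Proof.
move=> d0; pose t : 'I_d * bool := (Ordinal d0, false).
have inj : injective (fun k => step t *+ k).
  move=> j k /rowP/(_ t.1); rewrite !mulmxnE step_entry eqxx expr0 => jk.
  by apply/eqP; rewrite -(eqr_nat int); apply/eqP.
have : [seq step t *+ k | k <- iota 0 n.+1] \in
    fset_set (self_avoiding_paths d n.+1).
  rewrite in_fset_set ?inE; last exact: finite_self_avoiding_paths.
  split; [by rewrite size_map size_iota|by []| |].
  - apply/(sortedP 0) => i; rewrite size_map size_iota => iN.
    rewrite !(nth_map 0%N) ?size_iota ?(ltnW iN)// !nth_iota ?(ltnW iN)//.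
    by rewrite !add0n mulrSr adjacent_step.
  - by rewrite map_inj_uniq ?iota_uniq.
by rewrite cardfs_gt0 => sS; apply/fset0Pn; eexists; exact: sS.
Qed.

(** Fekete's lemma applies to u n = ln c_(n+1), where n counts steps, and
c_(n+1)^(1/(n+1)) is the exponential of (u n / n) (1 - 1/(n+1)). *)
Lemma connective_constant_cvg (R : realType) : (0 < d)%N ->
  (c n)%:R `^ n%:R^-1 @[n --> \oo] --> connective_constant R d.
Proof.
move=> d0; pose u n : R := ln (c n.+1)%:R.
have cR n : 0 < (c n.+1)%:R :> R by rewrite ltr0n card_saw_gt0.
have u_ge0 n : 0 <= u n by rewrite ln_ge0// ler1n card_saw_gt0.
have u_sub m n : u (m + n)%N <= u m + u n.
  rewrite /u -lnM ?posrE// -natrM ler_ln ?posrE ?ler_nat ?card_saw_submul//.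
  by rewrite ltr0n muln_gt0 !card_saw_gt0.
suff cv : (c n)%:R `^ n%:R^-1 @[n --> \oo] -->
    expR (inf [set u n.+1 / n.+1%:R | n in setT]).
  by rewrite /connective_constant (cvg_lim _ cv).
(* A shift by 2 avoids the division by n = 0 in u n / n. *)
rewrite -(cvg_shiftn 2).
rewrite (_ : [sequence _]_n =
    expR \o (fun n => u n.+1 / n.+1%:R * (1 - harmonic n.+1))).
  apply: continuous_cvg; first exact: continuous_expR.
  rewrite -[X in _ --> X]mulr1; apply: cvgM.
    by have := fekete u_ge0 u_sub; rewrite -cvg_shiftS.
  rewrite -[X in _ --> X]subr0; apply: cvgB; first exact: cvg_cst.
  by have := @cvg_harmonic R; rewrite -cvg_shiftS.
apply/funext => n /=; rewrite addn2 /powR gt_eqF//; congr expR.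
rewrite /u /harmonic/= mulrC -mulrA; congr (_ * _).
have n0 := ler0n R n; field; apply/andP.
by split; apply: lt0r_neq0; lra.
Qed.

Lemma connective_constant_ge1 (R : realType) : (0 < d)%N ->
  1 <= connective_constant R d.
Proof.
move=> d0; have cv := @connective_constant_cvg R d0.
rewrite -(cvg_lim _ cv)//; apply: limr_ge.
  by apply/cvg_ex; eexists; exact: cv.
near=> n.
have n0 : (0 < n)%N by near: n; exact: nbhs_infty_gt.
have c1 : 1 <= (c n)%:R :> R by rewrite ler1n -(prednK n0) card_saw_gt0.
by rewrite -[leLHS](powRr0 (c n)%:R) ler_powR.
Unshelve. all: by end_near. Qed.

End Connective.

(** * The subcritical regime *)

Section Subcritical.
Context (R : realType) (d : nat) (p : R).
Let P := bernoulli_product (edge d) p.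

(** The union bound is the n-th power of c_n^(1/n) (1-p)^(2d-1), whose limit
is less than 1. *)
Lemma prob_infinite_chordless_shielded x : (0 < d)%N -> 0 <= p <= 1 ->
    connective_constant R d * (1 - p) ^+ (2 * d - 1) < 1 ->
  P (\bigcap_n chordless_shielded x n.+1) = 0%E.
Proof.
move=> d0 p01 sub; apply/eqP; rewrite -measure_le0.
apply/lee_addgt0Pr => eps eps0; rewrite add0e.
set q := 1 - p in sub; set k := (2 * d - 1)%N in sub.
have /andP[p0 p1] := p01; have q0 : 0 <= q by rewrite subr_ge0.
set lam := connective_constant R d in sub.
have lam1 : 1 <= lam by exact: connective_constant_ge1.
have qk0 : 0 <= q ^+ k by exact: exprn_ge0.
(* Any r strictly between the limit and 1 works. *)
pose r := (lam * q ^+ k + 1) / 2.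
have lam_qk0 : 0 <= lam * q ^+ k by apply: mulr_ge0 => //; lra.
have r0 : 0 <= r by rewrite /r; lra.
have r1 : r < 1 by rewrite /r; lra.
pose c n : R := #|` fset_set (self_avoiding_paths d n)|%:R.
have cr : \forall n \near \oo, c n `^ n%:R^-1 * q ^+ k <= r.
  apply: (cvgr_le (lam * q ^+ k)); last by rewrite /r; lra.
  by apply: cvgM; [exact: connective_constant_cvg|exact: cvg_cst].
have er : \forall n \near \oo, r ^+ n < eps.
  by apply: (cvgr_lt 0) => //; apply: cvg_expr; rewrite ger0_norm.
near \oo => n.
have n0 : (0 < n)%N by near: n; exact: nbhs_infty_gt.
apply: (@le_trans _ _ (P (chordless_shielded x n))).
  apply: le_measure; rewrite ?inE.
  - by apply: bigcapT_measurable => m; exact: measurable_chordless_shielded.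
  - exact: measurable_chordless_shielded.
  - by move=> w /(_ n.-1 I); rewrite prednK.
apply: le_trans (prob_chordless_shielded_le p01 x n) _.
rewrite lee_fin -/q -/k -/(c n).
apply: (@le_trans _ _ (r ^+ n)); last by apply: ltW; near: n.
rewrite exprM.
have -> : c n = (c n `^ n%:R^-1) ^+ n.
  rewrite -powR_mulrn ?powR_ge0// -powRrM mulVf ?powRr1// ?ler0n//.
  by rewrite pnatr_eq0 -lt0n.
rewrite -exprMn; apply: lerXn2r.
- by rewrite nnegrE mulr_ge0// powR_ge0.
- by rewrite nnegrE.
- by near: n.
Unshelve. all: by end_near. Qed.

Lemma prob_infinite_shielded_path : (0 < d)%N -> 0 <= p <= 1 ->
    connective_constant R d * (1 - p) ^+ (2 * d - 1) < 1 ->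
  P [set w | has_infinite_shielded_path w] = 0%E.
Proof.
move=> d0 p01 sub; rewrite has_infinite_shielded_pathE.
pose H x : set (config (edge d)) := \bigcap_n chordless_shielded x n.+1.
have mH x : measurable (H x).
  by apply: bigcapT_measurable => m; exact: measurable_chordless_shielded.
pose F n := if choice.unpickle n is Some x then H x else set0.
have mF n : measurable (F n) by rewrite /F; case: (choice.unpickle n).
apply/eqP; rewrite -measure_le0.
apply: (@le_trans _ _ (\sum_(0 <= n <oo) P (F n))%E).
  apply: measure_sigma_subadditive => //.
    by apply: countable_bigcupT_measurable => //; exact: countableP.
  move=> w [x _ wx]; exists (choice.pickle x) => //.
  by rewrite /F choice.pickleK.
rewrite eseries0// => n _ _; rewrite /F; case: (choice.unpickle n) => // x.
exact: prob_infinite_chordless_shielded.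
Qed.

End Subcritical.

Theorem theorem1p1 (R : realType) (d : nat) (hd : (1 <= d)%N) :
  p_shield R d <= 1 - connective_constant R d `^ (- (1 / (2 * d%:R - 1))).
Proof.
have lam1 := @connective_constant_ge1 d R hd.
set lam := connective_constant R d in lam1 *.
pose k := (2 * d - 1)%N.
have k0 : (0 < k)%N by rewrite /k; lia.
have kR : 2 * d%:R - 1 = k%:R :> R by rewrite /k natrB ?natrM//; lia.
rewrite kR div1r /p_shield; set S := [set _ | _].
have [->|/set0P S0] := eqVneq S set0.
  (* The supremum of the empty set is 0, which is below the bound since the
     connective constant is at least 1. *)
  rewrite sup0 subr_ge0 powRN invf_le1 ?powR_gt0//; last lra.
  by rewrite -[leLHS](powRr0 lam) ler_powR.
apply: ge_sup => // p [/= p01 Ppos]; rewrite lerBrDr -lerBrDl leNgt.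
apply/negP => qlt; move: Ppos; rewrite prob_infinite_shielded_path ?ltxx//.
rewrite -/lam -/k -ltr_pdivlMl ?mulr1; last lra.
have /andP[p0 p1] := p01.
have -> : lam^-1 = (lam `^ - k%:R^-1) ^+ k.
  rewrite -powR_mulrn ?powR_ge0// -powRrM mulNr mulVf ?powR_inv1//; first lra.
  by rewrite pnatr_eq0 -lt0n.
by rewrite ltrXn2r ?subr_ge0// -lt0n.
Qed.
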